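(* Let $n\ge 3$, let $P_n$ be the regular $n$-gon with vertices $v_{n,i}=(\cos\frac{2\pi(i-1)}{n},\sin\frac{2\pi(i-1)}{n})$, $1\le i\le n$, and let $\mathcal{T}_n$ be a uniformly random triangulation of $P_n$. For $1\le i\le n-2$ let $\mathcal{A}_{n,i}$ be the number of triangles of $\mathcal{T}_n$ incident with vertex $v_{n,1}$ whose angle at $v_{n,1}$ has size $\frac{\pi i}{n}$. Then for every sequence of integers $0\le k_1,\dots,k_{n-2}\le n-2$ with $\sum_{i=1}^{n-2} i k_i=n-2$, $$\mathbb{P}(\mathcal{A}_{n,1}=k_1,\dots,\mathcal{A}_{n,n-2}=k_{n-2})=\frac{K(2n-K-5)!}{Z_{n,K}\,C_{n-2}\,(n-K-2)!\,(n-2)!}\binom{K}{k_1,\dots,k_{n-2}}C_0^{k_1}C_1^{k_2}\cdots C_{n-3}^{k_{n-2}},$$ where $K:=\sum_{i=1}^{n-2}k_i$ and $$Z_{n,K}:=\sum_{\substack{\sum_{j=1}^{n-2} jp_j=n-2\\ \sum_{j=1}^{n-2}p_j=K\\ 0\le p_j\le n-2}}\binom{K}{p_1,\dots,p_{n-2}}C_0^{p_1}\cdots C_{n-3}^{p_{n-2}}.$$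
   Context: A triangulation of $P_n$ is a set of $n-3$ noncrossing diagonals partitioning $P_n$ into $n-2$ triangles; there are $C_{n-2}$ of them, where $C_k=\frac{1}{k+1}\binom{2k}{k}$ is the $k$-th Catalan number, and $\mathcal{T}_n$ is chosen uniformly among them. The triangle with vertices $v_{n,1},v_{n,j},v_{n,j+i}$ ($2\le j<j+i\le n$) has angle $\frac{\pi i}{n}$ at $v_{n,1}$. $\binom{K}{p_1,\dots,p_{n-2}}=\frac{K!}{p_1!\cdots p_{n-2}!}$ is the multinomial coefficient, and the sum defining $Z_{n,K}$ is over integer tuples $(p_1,\dots,p_{n-2})$. *)

(* Defs.v *)
From HB Require Import structures.
From mathcomp Require Import all_boot all_order all_algebra.
From mathcomp Require Import all_classical all_reals all_analysis.

Set Implicit Arguments.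
Unset Strict Implicit.
Unset Printing Implicit Defensive.

Import Order.TTheory GRing.Theory Num.Theory.

Local Open Scope classical_set_scope.
Local Open Scope ring_scope.

(* Plane geometry uses explicit Euclidean formulas: the library norm on a
   product of normed spaces is the sup norm. *)

Definition plane (R : realType) : Type := (R * R)%type.

Definition dot (R : realType) (u v : plane R) : R := u.1 * v.1 + u.2 * v.2.

Definition vec (R : realType) (p q : plane R) : plane R :=
  (q.1 - p.1, q.2 - p.2).

Definition enorm (R : realType) (u : plane R) : R := Num.sqrt (dot u u).

(* The angle at the apex o of the triangle o, p, q. *)
Definition angle (R : realType) (o p q : plane R) : R :=
  acos (dot (vec o p) (vec o q) / (enorm (vec o p) * enorm (vec o q))).

(* The index i : 'I_n stands for the vertex v_{n,i+1}; in particular v_{n,1}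
   has index 0. *)
Definition vertex (R : realType) (n : nat) (i : 'I_n) : plane R :=
  (cos (2 * pi * i%:R / n%:R), sin (2 * pi * i%:R / n%:R)).

(* Chords and triangles spanned by vertices are represented by their vertex
   sets. *)

Definition hull (R : realType) (n : nat) (s : {set 'I_n}) : set (plane R) :=
  [set x | exists w : 'I_n -> R,
     [/\ forall i, i \in s -> 0 <= w i,
         \sum_(i in s) w i = 1 &
         x = (\sum_(i in s) w i * (vertex R i).1,
              \sum_(i in s) w i * (vertex R i).2)]].

Arguments hull R {n} s.

(* All weights positive: the relative interior of [hull R s]. *)
Definition open_hull (R : realType) (n : nat) (s : {set 'I_n}) :
    set (plane R) :=
  [set x | exists w : 'I_n -> R,
     [/\ forall i, i \in s -> 0 < w i,
         \sum_(i in s) w i = 1 &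
         x = (\sum_(i in s) w i * (vertex R i).1,
              \sum_(i in s) w i * (vertex R i).2)]].

Arguments open_hull R {n} s.

(* [ordS] is the cyclic successor on 'I_n. *)
Definition is_side (n : nat) (e : {set 'I_n}) : bool :=
  [exists i : 'I_n, e == [set i; ordS i]%SET].

Definition is_diagonal (n : nat) (e : {set 'I_n}) : bool :=
  (#|e| == 2)%N && ~~ is_side e.

Definition noncrossing (R : realType) (n : nat) (D : {set {set 'I_n}}) : Prop :=
  forall e f : {set 'I_n}, e \in D -> f \in D -> e != f ->
    open_hull R e `&` open_hull R f = set0.

Definition triangles (n : nat) (D : {set {set 'I_n}}) : {set {set 'I_n}} :=
  [set t : {set 'I_n} | (#|t| == 3)%N &&
    [forall i in t, forall j in t,
       (i != j) ==> is_side [set i; j]%SET || ([set i; j]%SET \in D)]]%SET.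

Definition is_triangulation (R : realType) (n : nat) (D : {set {set 'I_n}}) :
    Prop :=
  [/\ forall e, e \in D -> is_diagonal e,
      #|D| = (n - 3)%N,
      noncrossing R D,
      #|triangles D| = (n - 2)%N &
      hull R [set: 'I_n]%SET = \bigcup_(t in [set` triangles D]) hull R t /\
      (forall t u, t \in triangles D -> u \in triangles D -> t != u ->
         open_hull R t `&` open_hull R u = set0)].

Definition triangulations (R : realType) (n : nat) : {set {set {set 'I_n}}} :=
  [set D : {set {set 'I_n}} | `[< is_triangulation R D >]]%SET.

(* The number of triangles of D incident with v_{n,1} whose angle at v_{n,1}
   is pi * i / n. *)
Definition angle_count (R : realType) (n : nat) (i : nat)
    (D : {set {set 'I_n}}) : nat :=
  #|[set t in triangles D |
      [exists a : 'I_n, exists b : 'I_n, exists c : 'I_n,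
         [&& nat_of_ord a == 0%N, t == [set a; b; c]%SET &
             angle (vertex R a) (vertex R b) (vertex R c)
               == pi * i%:R / n%:R]]]%SET|.

Definition uniform_on d (Omega : measurableType d) (R : realType)
    (P : probability Omega R) (I : finType) (X : Omega -> I) (S : {set I}) :
    Prop :=
  forall x : I, measurable (X @^-1` [set x]) /\
    P (X @^-1` [set x]) = ((x \in S)%:R / #|S|%:R)%:E.

Definition catalan (R : realType) (k : nat) : R :=
  'C(2 * k, k)%:R / k.+1%:R.

Definition multinomial (R : realType) (m K : nat) (p : 'I_m -> nat) : R :=
  K`!%:R / \prod_(j < m) (p j)`!%:R.

(* A tuple (p_1, ..., p_m) is a function p on 'I_m with p j = p_{j+1}. *)
Definition weight (R : realType) (m K : nat) (p : 'I_m -> nat) : R :=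
  multinomial R K p * \prod_(j < m) catalan R j ^+ p j.

Definition Z (R : realType) (n K : nat) : R :=
  \sum_(p : {ffun 'I_(n - 2) -> 'I_(n - 2).+1} |
      (\sum_(j < n - 2) j.+1 * p j == n - 2)%N &&
      (\sum_(j < n - 2) p j == K)%N)
    weight R K (fun j => p j : nat).

(* Main.v *)
(* Cutting along the edge joining v_{n,1} to v_{n,n} identifies triangulations
   of P_n with binary trees with N = n - 2 nodes: a node stands for a triangle
   and its subtrees for the two polygons cut off by the other two sides of that
   triangle.  The triangles at v_{n,1} form the left spine of the tree, and by
   the inscribed angle theorem the angle at v_{n,1} of such a triangle is
   pi (r + 1) / n, where r is the size of the right subtree of its node.
   Removing the root shows that multinomial(k) * prod_j C_j ^ k_j trees have
   k_j right subtrees of size j on the left spine.  Hence Z_{n,K} counts the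
   trees whose left spine has length K, and tree rotation gives the recursion
   of the ballot numbers K (2N - K - 1)! / (N! (N - K)!) for that count. *)

Require Import Defs.
From HB Require Import structures.
From mathcomp Require Import all_boot all_order all_algebra.
From mathcomp Require Import all_classical all_reals all_analysis.
From mathcomp Require Import zify ring.

Import Order.TTheory GRing.Theory Num.Theory.

(** * Binary trees and their left spines *)

Section Trees.
Set Implicit Arguments.
Unset Strict Implicit.

(** The factor [K (2n - K - 5)! / ((n - K - 2)! (n - 2)!)] is the ballot number, hence equal to
    [Z_{n,K}]: the formula says that the probability is the weight of [k] divided by [C_{n-2}].
    Counts are stated over [nat] with all denominators multiplied out. The obstacle is to match
    trees with triangulations, since the latter are defined through convex hulls of real points.
    Hull arguments are reduced to the sign of [ori] on triples of polygon vertices. From a tree to a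
    triangulation, separating lines give disjoint interiors and a descent in the tree gives the
    covering. The converse is an extremal statement: at most [N] pairwise noncrossing chords fit on
    [N + 2] consecutive vertices if the base is counted as a chord, and equality holds only for the
    chords of a tree. Counting the base makes the chords of a tree as many as its nodes and lets
    subtrees be treated like the whole tree. *)

Inductive tree := Leaf | Node of tree & tree.

Lemma tree_comparable : comparable tree.
Proof. by rewrite /comparable /decidable; decide equality. Qed.
HB.instance Definition _ := comparableMixin tree_comparable.

Fixpoint tsize t := if t is Node l r then (tsize l + tsize r).+1 else 0.

Fixpoint spine t := if t is Node l r then tsize r :: spine l else [::].

(** The recursion on sizes is not structural, so [f] is fuel; any [f >= n] suffices, and the empty
    list marks exhausted fuel. *)
Fixpoint trees_rec f n :=
  match f, n with
  | f'.+1, n'.+1 =>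
    [seq Node p.1 p.2 | i <- iota 0 n,
       p <- [seq (l, r) | l <- trees_rec f' (n' - i), r <- trees_rec f' i]]
  | _, 0 => [:: Leaf]
  | _, _ => [::]
  end.

Definition trees n := trees_rec n n.

Lemma trees_recS f n : trees_rec f.+1 n.+1 =
  [seq Node p.1 p.2 | i <- iota 0 n.+1,
     p <- [seq (l, r) | l <- trees_rec f (n - i), r <- trees_rec f i]].
Proof. by []. Qed.

Lemma trees_recE f n : n <= f -> trees_rec f n = trees n.
Proof.
suff H f1 f2 m : m <= f1 -> m <= f2 -> trees_rec f1 m = trees_rec f2 m.
  by move=> le_nf; apply: H.
elim: f1 f2 m => [|f1 IH] [|f2] [|m] //; rewrite !ltnS => m1 m2.
rewrite !trees_recS.
congr flatten; apply/eq_in_map => i; rewrite mem_iota => /andP[_ lt_im].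
by rewrite (IH f2 (m - i)) ?(IH f2 i) //; lia.
Qed.

Lemma treesS n : trees n.+1 =
  [seq Node p.1 p.2 | i <- iota 0 n.+1,
     p <- [seq (l, r) | l <- trees (n - i), r <- trees i]].
Proof.
rewrite /trees trees_recS.
congr flatten; apply/eq_in_map => i; rewrite mem_iota => /andP[_ lt_im].
by rewrite !trees_recE //; lia.
Qed.

Lemma mem_trees n t : (t \in trees n) = (tsize t == n).
Proof.
elim: t n => [|l IHl r IHr] [|n].
- by rewrite inE eqxx.
- by rewrite treesS; apply/negbTE/negP => /allpairsPdep[i [p [_ _]]].
- by rewrite inE; apply/eqP.
rewrite treesS; apply/allpairsPdep/idP.
  move=> [i [[l' r'] [+ /allpairsP[[l0 r0] [/= + + [-> ->]]] [e1 e2]]]].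
  by rewrite -e1 -e2 IHl IHr mem_iota /= => ? /eqP ? /eqP ?; lia.
move=> /eqP[/= sz]; exists (tsize r), (l, r); split => //.
  by rewrite inE mem_iota; lia.
by apply: allpairs_f; rewrite ?IHl ?IHr; lia.
Qed.

Lemma uniq_trees n : uniq (trees n).
Proof.
elim/ltn_ind: n => -[|n] IH //.
rewrite treesS; apply: allpairs_uniq_dep; first exact: iota_uniq.
  move=> i; rewrite mem_iota => Hi; apply: allpairs_uniq; try (apply: IH; lia).
  by case=> a b [c d] _ _ [-> ->].
move=> _ _ /allpairsPdep[i [[l r] [_ H ->]]] /allpairsPdep[j [[l' r'] [_ H' ->]]].
move=> /= [el er]; subst l' r'.
have {H}/allpairsP[[l0 r0] [_ /= Hi [_ er]]] := H.
have {H'}/allpairsP[[l1 r1] [_ /= Hj [_ er']]] := H'.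
by move: Hi Hj; rewrite -er -er' !mem_trees => /eqP-> /eqP->.
Qed.

Lemma size_spine_le t : size (spine t) <= tsize t.
Proof. by elim: t => //= l IHl r _; lia. Qed.

(** Every node lies on the left spine or in the right subtree of exactly one spine node. In terms of
    multiplicities this is the constraint that the [j.+1 * p j] add up to [n - 2]. *)
Lemma sum_spine t : sumn (spine t) + size (spine t) = tsize t.
Proof. by elim: t => //= l IHl r _; lia. Qed.

Definition spine_trees n K := [seq t <- trees n | size (spine t) == K].

Lemma mem_spine_trees n K t :
  (t \in spine_trees n K) = (size (spine t) == K) && (tsize t == n).
Proof. by rewrite mem_filter mem_trees. Qed.

(** Merges the first two spine entries [x], [y] into [x + y + 1]. It is injective on trees with at
    least two spine nodes; on the others it is a mere default. *)
Definition rotr_tree t :=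
  if t is Node (Node l a) b then Node l (Node a b) else t.

Lemma uniq_spine_trees n K : uniq (spine_trees n K).
Proof. by rewrite filter_uniq ?uniq_trees. Qed.

(* A tree whose top right subtree is a leaf loses its root; any other tree is
   rotated, which lengthens the left spine by one. *)
Lemma size_spine_treesS n K :
  size (spine_trees n.+1 K.+1) =
  size (spine_trees n K) + size (spine_trees n.+1 K.+2).
Proof.
rewrite -(size_map (Node^~ Leaf) (spine_trees n K)).
rewrite -(size_map rotr_tree (spine_trees _ K.+2)) -size_cat.
apply/perm_size/uniq_perm.
- exact: uniq_spine_trees.
- rewrite cat_uniq; apply/and3P; split.
  + by rewrite map_inj_uniq ?uniq_spine_trees // => x y [].
  + apply/hasPn => _ /mapP[t + ->]; rewrite mem_spine_trees.
    case: t => [|[|l a] b] //= _.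
    by apply/mapP => -[].
  + rewrite map_inj_in_uniq ?uniq_spine_trees // => x y.
    rewrite !mem_spine_trees; case: x => [|[|? ?] ?] //; case: y => [|[|? ?] ?] //.
    by move=> _ _ [-> -> ->].
move=> t; rewrite mem_cat mem_spine_trees; apply/idP/orP.
  case: t => [|l [|a b]] //= /andP[sp sz]; [left|right]; apply/mapP.
    by exists l => //; rewrite mem_spine_trees; lia.
  by exists (Node (Node l a) b) => //; rewrite mem_spine_trees /=; lia.
by case=> /mapP[t' + ->]; rewrite mem_spine_trees;
  [|case: t' => [|[|l a] b] //]; move=> /=; lia.
Qed.

(** Here [s] is the number of nodes off the spine. Of the two terms of [size_spine_treesS], one
    keeps [s] and lowers [K], the other lowers [s]; hence the nested inductions. The hypothesis
    excludes the empty tree, where the left side is 1 and the right side 0. *)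
Lemma ballot K s : 0 < K + s ->
  size (spine_trees (K + s) K) * (s`! * (s + K)`!) = K * (2 * s + K).-1`!.
Proof.
have spine_trees_gt n k : n < k -> size (spine_trees n k) = 0.
  move=> lt_nk; case E: (spine_trees n k) => [//|t s'].
  have: t \in spine_trees n k by rewrite E mem_head.
  by rewrite mem_spine_trees; have := size_spine_le t; lia.
have spine_trees0 n : size (spine_trees n.+1 0) = 0.
  case E: (spine_trees n.+1 0) => [//|t s'].
  have: t \in spine_trees n.+1 0 by rewrite E mem_head.
  by rewrite mem_spine_trees; case: t {E}.
elim: s K => [|s IHs] K.
  rewrite addn0; case: K => // K _.
  have -> : size (spine_trees K.+1 K.+1) = 1.
    elim: K => [//|K IH]; rewrite size_spine_treesS IH spine_trees_gt //.
  by rewrite fact0 !mul1n muln0 add0n factS.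
elim: K => [|K IHK] _; first by rewrite add0n spine_trees0.
have := IHs K.+2 isT; have := IHK ltac:(lia).
have -> : K.+2 + s = (K + s).+2 by lia.
have -> : K + s.+1 = (K + s).+1 by lia.
have -> : K.+1 + s.+1 = (K + s).+2 by lia.
have -> : s.+1 + K = (s + K).+1 by lia.
have -> : s.+1 + K.+1 = (s + K).+2 by lia.
have -> : s + K.+2 = (s + K).+2 by lia.
have -> : (2 * s + K.+2).-1 = (2 * s + K).+1 by lia.
have -> : (2 * s.+1 + K.+1).-1 = (2 * s + K).+2 by lia.
have -> : (2 * s.+1 + K).-1 = (2 * s + K).+1 by lia.
rewrite !factS => e1 e2; rewrite size_spine_treesS.
set X := size _ in e1 *; set Y := size _ in e2 *; set u := s`! in e1 e2 *.
set v := (s + K)`! in e1 e2 *; set w := (2 * s + K)`! in e1 e2 *.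
(* Over a common multiple of the two factorial products, the step comes down to [(s + K + 2) K + (s
   + 1)(K + 2) = (K + 1)(2s + K + 2)]. *)
have -> : (X + Y) * (s.+1 * u * ((s + K).+2 * ((s + K).+1 * v))) =
  (s + K).+2 * (X * (s.+1 * u * ((s + K).+1 * v))) +
  s.+1 * (Y * (u * ((s + K).+2 * ((s + K).+1 * v)))) by lia.
by rewrite e1 e2; lia.
Qed.

(** A one-node spine leaves the right subtree of the root arbitrary, so Catalan numbers are the
    ballot numbers with [K = 1]. *)
Lemma size_treesE n : size (trees n) = size (spine_trees n.+1 1).
Proof.
rewrite -(size_map (Node Leaf) (trees n)); apply/perm_size/uniq_perm.
- by rewrite map_inj_uniq ?uniq_trees // => x y [].
- exact: uniq_spine_trees.
move=> t; rewrite mem_spine_trees; apply/mapP/idP.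
  by case=> t'; rewrite mem_trees => ? ->.
by case: t => [|[|? ?] r] // => sz; exists r => //; rewrite mem_trees; move: sz => /=; lia.
Qed.

Lemma size_trees n : size (trees n) * n.+1 = 'C(2 * n, n).
Proof.
have := @ballot 1 n isT; rewrite add1n -size_treesE addn1 mul1n /= addn1 /= factS.
have := @bin_fact (2 * n) n; rewrite leq_pmull // => /(_ isT).
have -> : 2 * n - n = n by lia.
move=> <- e; apply/eqP; rewrite -(eqn_pmul2r (m := n`! * n`!)) ?muln_gt0 ?fact_gt0 //.
by apply/eqP; rewrite -e; lia.
Qed.

Lemma big_treesS n (G : tree -> nat) : \sum_(t <- trees n.+1) G t =
  \sum_(i < n.+1) \sum_(l <- trees (n - i)) \sum_(r <- trees i) G (Node l r).
Proof.
rewrite treesS big_allpairs_dep -[iota 0 n.+1]/(index_iota 0 n.+1) big_mkord.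
by apply: eq_bigr => i _; rewrite big_allpairs.
Qed.

(** [M] stays fixed while an induction passes to smaller trees, so that only [k] changes. Spine
    entries from [M] on are not tested; they do not occur in trees of size at most [M]. *)
Definition has_spine M (k : nat -> nat) t :=
  all (fun j => count_mem j (spine t) == k j) (iota 0 M).

(** The root uses up one occurrence of [tsize r]; the guard is there because subtraction in [nat]
    truncates at 0. *)
Lemma has_spine_Node M k l r : tsize r < M ->
  has_spine M k (Node l r) =
  (0 < k (tsize r)) && has_spine M (fun j => k j - (j == tsize r)) l.
Proof.
move=> lt_rM; apply/allP/andP => [H|[k_gt0 /allP H] j jM].
  split; first by have := H (tsize r); rewrite mem_iota /= eqxx; lia.
  by apply/allP => j /H /=; rewrite (eq_sym j); lia.
by have := H j jM; rewrite /= eq_sym; case: (eqVneq j (tsize r)) => [->|_] /=; lia.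
Qed.

(** Sorting trees by the size [i] of the right subtree of the root mirrors Pascal's rule for
    multinomials, which lowers one [k i] at a time. Cleared of denominators, with [K] the sum of the
    [k i], that rule is [K! = sum_i k_i (K - 1)!]. *)
Lemma count_has_spine M (k : nat -> nat) n : n <= M ->
  \sum_(j < M) j.+1 * k j = n ->
  count (has_spine M k) (trees n) * \prod_(j < M) (k j)`! =
  (\sum_(j < M) k j)`! * \prod_(j < M) size (trees j) ^ k j.
Proof.
elim/ltn_ind: n k => -[|n] IH k le_nM wt.
  have k0 (j : 'I_M) : k j = 0.
    move/eqP: wt; rewrite sum_nat_eq0 => /forallP/(_ j)/implyP/(_ isT).
    by rewrite muln_eq0 => /eqP.
  rewrite !big1 => [|j _|j _|j _]; rewrite ?k0 //.
  suff: has_spine M k Leaf by rewrite /= => ->.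
  by apply/allP => j; rewrite mem_iota add0n => jM; rewrite (k0 (Ordinal jM)).
(* A size [i] that still occurs satisfies [i.+1 <= n.+1], so letting [i] range below [M] adds no
   term to the sum over the possible roots. *)
have k_le (i : 'I_M) : 0 < k i -> i < n.+1.
  by move=> ki; move: wt; rewrite (bigD1 i) //=; nia.
have K_gt0 : 0 < \sum_(j < M) k j.
  rewrite lt0n; apply/eqP => /eqP; rewrite sum_nat_eq0 => /forallP k0.
  move: wt; rewrite big1 // => j _.
  by have /implyP/(_ isT)/eqP -> := k0 j; rewrite muln0.
have -> : count (has_spine M k) (trees n.+1) =
    \sum_(i < M | 0 < k i)
      count (has_spine M (fun j => k j - (j == i))) (trees (n - i)) *
      size (trees i).
  rewrite -sum1_count big_mkcond big_treesS.
  rewrite (big_ord_widen _ (fun i => \sum_(l <- trees (n - i))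
     \sum_(r <- trees i) if has_spine M k (Node l r) then 1 else 0) le_nM).
  rewrite big_mkcond [RHS]big_mkcond; apply: eq_bigr => i _.
  have -> : \sum_(l <- trees (n - i))
      \sum_(r <- trees i) (if has_spine M k (Node l r) then 1 else 0) =
    (if 0 < k i then count (has_spine M (fun j => k j - (j == i)))
      (trees (n - i)) * size (trees i) else 0).
    case: ifP => ki; last first.
      rewrite big1_seq // => l _; rewrite big1_seq // => r /=.
      by rewrite mem_trees => /eqP er; rewrite has_spine_Node er ?ki.
    rewrite -sum1_count big_distrl /= [RHS]big_mkcond /=.
    apply: eq_bigr => l _.
    rewrite (eq_big_seq (fun=> nat_of_bool (has_spine M (fun j => k j - (j == i)) l))).
      by rewrite big_const_seq count_predT iter_addn_0; case: (has_spine _ _ _);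
        rewrite /= ?muln1 ?mul1n ?muln0 ?mul0n.
    by move=> r; rewrite mem_trees => /eqP er; rewrite has_spine_Node er ?ki //;
      case: (has_spine _ _ _).
  by case: ifP => //; case: ifP => // /k_le ->.
rewrite big_distrl /=.
have -> : (\sum_(j < M) k j)`! = \sum_(i < M | 0 < k i) k i * (\sum_(j < M) k j).-1`!.
  rewrite -big_distrl /= -{1}(prednK K_gt0) factS prednK //; congr muln.
  by rewrite [RHS]big_mkcond; apply: eq_bigr => i _; case: (k i).
rewrite big_distrl /=; apply: eq_bigr => i ki.
pose k' j := k j - (j == i).
have ek' (j : 'I_M) : j != i -> k' j = k j by rewrite /k' -val_eqE => /negbTE ->; rewrite subn0.
have eki : k' i = (k i).-1 by rewrite /k' eqxx subn1.
have := IH (n - i) _ k' _ _; have := k_le i ki.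
rewrite -/k' => lt_in /(_ ltac:(lia) ltac:(lia)).
have -> : \sum_(j < M) j.+1 * k' j = n - i.
  move: wt; rewrite (bigD1 i) //= [X in _ -> X = _](bigD1 i) //= eki.
  by under [X in _ -> _ + X = _]eq_bigr => j ji do rewrite ek' //; nia.
have -> : \sum_(j < M) k' j = (\sum_(j < M) k j).-1.
  rewrite (bigD1 i) //= [X in _ = X.-1](bigD1 i) //= eki.
  by under eq_bigr => j ji do rewrite ek' //; lia.
have -> : \prod_(j < M) (k j)`! = k i * \prod_(j < M) (k' j)`!.
  rewrite (bigD1 i) //= [in RHS](bigD1 i) //= eki mulnA; congr (_ * _).
    by rewrite -{1 2}(prednK ki) factS.
  by apply: eq_bigr => j ji; rewrite ek'.
have -> : \prod_(j < M) size (trees j) ^ k j =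
    size (trees i) * \prod_(j < M) size (trees j) ^ k' j.
  rewrite (bigD1 i) //= [in RHS](bigD1 i) //= eki mulnA; congr (_ * _).
    by rewrite -{1}(prednK ki) expnS.
  by apply: eq_bigr => j ji; rewrite ek'.
move=> /(_ erefl) e; transitivity (k i * size (trees i) *
  (count (has_spine M k') (trees (n - i)) * \prod_(j < M) (k' j)`!)).
  by rewrite -/k'; lia.
by rewrite e mulnACA.
Qed.

End Trees.

(** * The chords cut out by a tree *)

Section Chords.
Set Implicit Arguments.
Unset Strict Implicit.

(* The tree t sits on the vertices a, ..., a + tsize t + 1; a node yields its
   triangle as (left end of the base, apex, right end of the base). *)
Fixpoint nodes a t : seq (nat * nat * nat) :=
  if t is Node l r then
    (a, a + (tsize l).+1, a + (tsize t).+1)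
      :: nodes a l ++ nodes (a + (tsize l).+1) r
  else [::].

(** These are the bases of the nodes, including the outermost one, which is a side of the polygon
    when [t] is the whole tree. *)
Fixpoint diags a t : seq (nat * nat) :=
  if t is Node l r then
    (a, a + (tsize t).+1) :: diags a l ++ diags (a + (tsize l).+1) r
  else [::].

(* Not symmetric: p is the chord that starts first. *)
Definition crosses (p q : nat * nat) := (p.1 < q.1) && (q.1 < p.2 < q.2).

Definition noncross (F : seq (nat * nat)) := {in F &, forall p q, ~~ crosses p q}.

(** Only sides between consecutive indices are added; the side joining the last vertex to the first
    is the outermost base in [diags]. *)
Definition edge (F : seq (nat * nat)) x y := (y == x.+1) || ((x, y) \in F).

Lemma size_diags a t : size (diags a t) = tsize t.
Proof. by elim: t a => //= l IHl r IHr a; rewrite size_cat IHl IHr. Qed.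

Lemma diags_bound a t x y : (x, y) \in diags a t ->
  [/\ a <= x, x.+1 < y & y <= a + (tsize t).+1].
Proof.
elim: t a => //= l IHl r IHr a; rewrite inE mem_cat xpair_eqE.
case/or3P=> [|/IHl[]|/IHr[]]; last by split; lia.
  by move=> /andP[/eqP-> /eqP->]; split; lia.
by split; lia.
Qed.

Lemma uniq_diags a t : uniq (diags a t).
Proof.
elim: t a => //= l IHl r IHr a; rewrite mem_cat cat_uniq IHl IHr andbT.
apply/andP; split.
  by apply/negP => /orP[] /diags_bound[]; lia.
apply/hasPn => -[x y] /diags_bound[? ? ?]; apply/negP => /diags_bound[]; lia.
Qed.

Lemma noncross_diags a t : noncross (diags a t).
Proof.
elim: t a => //= l IHl r IHr a [x y] [z u].
rewrite !inE !mem_cat !xpair_eqE /crosses /=.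
case/or3P=> [/andP[/eqP-> /eqP->]|xyl|xyr];
  case/or3P=> [/andP[/eqP-> /eqP->]|zul|zur];
  try by [have := IHl _ _ _ xyl zul|have := IHr _ _ _ xyr zur];
  repeat match goal with H : is_true (_ \in diags _ _) |- _ =>
    move/diags_bound: H => [? ? ?] end; lia.
Qed.

Lemma noncross_edge F x y z u : noncross F -> edge F x y -> edge F z u ->
  ~~ crosses (x, y) (z, u).
Proof.
move=> ncF /orP[/eqP->|xy] /orP[/eqP->|zu]; last exact: ncF;
  by rewrite /crosses /=; lia.
Qed.

(** The chords determine the apex of the root: apart from the base, the longest chord starting at
    [a] is the base of the left subtree, and there is none if that subtree is a leaf. *)
Lemma diags_inj a t t' : tsize t = tsize t' -> diags a t =i diags a t' -> t = t'.
Proof.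
elim: t a t' => [|l IHl r IHr] a [|l' r'] //= [sz] E.
have size_le l1 r1 l2 r2 : tsize l1 + tsize r1 = tsize l2 + tsize r2 ->
    diags a (Node l1 r1) =i diags a (Node l2 r2) -> tsize l2 <= tsize l1.
  case: (posnP (tsize l2)) => [->//|l2_gt0] sz' E'.
  have: (a, a + (tsize l2).+1) \in diags a (Node l2 r2).
    by rewrite inE mem_cat; case: (l2) l2_gt0 => //= l3 l4 _; rewrite mem_head orbT.
  rewrite -E' inE mem_cat xpair_eqE.
  by case/or3P=> [/andP[_ /eqP]|/diags_bound[_ _]|/diags_bound[]] /=; lia.
have szl : tsize l = tsize l'.
  by apply/eqP; rewrite eqn_leq (size_le l r l' r') ?(size_le l' r' l r).
have szr : tsize r = tsize r' by lia.
congr Node; [apply: (IHl a) => // -[x y]|apply: (IHr (a + (tsize l).+1)) => // -[x y]];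
  have := E (x, y); rewrite !inE !mem_cat !xpair_eqE -szl -szr => Exy.
  apply/idP/idP => xy; have [? ? ?] := diags_bound xy; move: Exy;
  rewrite xy ?orbT /=.
    case/esym/or3P => [||/diags_bound[]]; lia.
  case/or3P => [||/diags_bound[]]; lia.
apply/idP/idP => xy; have [? ? ?] := diags_bound xy; move: Exy;
  rewrite xy ?orbT /=.
  case/esym/or3P => [|/diags_bound[]|]; lia.
case/or3P => [|/diags_bound[]|]; lia.
Qed.

(** The base contributes at most one chord, and the apex splits the others into families over [L1]
    and [L2] with [L1 + L2 + 1 = L]. Equality forces the base to be present and both families to be
    extremal, which yields the root and its two subtrees. *)
Lemma noncross_max a L (F : seq (nat * nat)) : uniq F -> noncross F ->
  (forall x y : nat, (x, y) \in F -> [/\ a <= x, x.+1 < y & y <= a + L.+1]) ->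
  size F <= L /\ (size F = L -> exists2 t, tsize t = L & F =i diags a t).
Proof.
elim/ltn_ind: L a F => L IH a F uF ncF bF.
case: (posnP L) => [L0|L_gt0].
  have F0 : F = [::].
    by case: F bF {IH uF ncF} => // -[x y] F /(_ x y); rewrite mem_head => /(_ isT)[]; lia.
  by rewrite F0 L0; split=> // _; exists Leaf.
pose b := a + L.+1; have eb : b = a + L.+1 by [].
pose Y y := (y < b) && edge F a y.
have exY : exists y, Y y by exists a.+1; rewrite /Y /edge eqxx andbT /b; lia.
have Yb y : Y y -> y <= b by case/andP=> /ltnW.
(* The vertex m is the apex over the base (a, b): no chord other than (a, b)
   straddles it, so F splits into its parts on [a, m] and [m, b]. *)
case: (ex_maxnP exY Yb) => m /andP[lt_mb am] m_max.
have lt_am : a < m.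
  by case/orP: am => [/eqP->|/bF[]]; lia.
pose F' : seq (nat * nat) := rem (a, b) F.
have inF' p : (p \in F') = (p != (a, b)) && (p \in F).
  by rewrite mem_rem_uniq.
pose F1 : seq (nat * nat) := [seq p <- F' | p.2 <= m].
pose F2 : seq (nat * nat) := [seq p <- F' | m < p.2].
have szF' : size F' = size F1 + size F2.
  rewrite !size_filter -(count_predC (fun p : nat * nat => p.2 <= m)); congr (_ + _).
  by apply: eq_count => p /=; rewrite ltnNge.
have szF : size F = ((a, b) \in F) + size F'.
  rewrite /F'; case: (boolP (_ \in F)) => [abF|abF]; last by rewrite rem_id.
  by rewrite size_rem // add1n prednK //; case: (F) abF.
have nc1 : noncross F1.
  by move=> p q; rewrite !mem_filter !inF' => /and3P[_ _ ?] /and3P[_ _ ?]; apply: ncF.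
have nc2 : noncross F2.
  by move=> p q; rewrite !mem_filter !inF' => /and3P[_ _ ?] /and3P[_ _ ?]; apply: ncF.
have u1 : uniq F1 by rewrite filter_uniq // rem_uniq.
have u2 : uniq F2 by rewrite filter_uniq // rem_uniq.
have [L1 eL1] : exists L1, m = a + L1.+1 by exists (m - a.+1); lia.
have [L2 eL2] : exists L2, b = m + L2.+1 by exists (b - m.+1); lia.
have [|sz1 t1] := IH L1 ltac:(lia) a F1 u1 nc1.
  by move=> x y; rewrite mem_filter inF' => /and3P[/= le_ym _ /bF[? ? ?]]; split; lia.
have [|sz2 t2] := IH L2 ltac:(lia) m F2 u2 nc2.
  move=> x y; rewrite mem_filter inF' xpair_eqE => /and3P[/= lt_my nab xy].
  have [? ? ?] := bF _ _ xy; split=> //; last by lia.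
  (* A chord ending beyond [m] but starting before it either crosses [(a, m)] or starts at [a]; the
     latter contradicts the maximality of [m], as the base has been removed. *)
  rewrite leqNgt; apply/negP => lt_xm; case: (ltnP a x) => [lt_ax|le_xa].
    have /orP[/eqP|amF] := am; first by lia.
    by have := ncF _ _ amF xy; rewrite /crosses /=; lia.
  have ex : x = a by lia.
  subst x; have := m_max y; rewrite /Y /edge xy orbT andbT.
  move: nab; rewrite eqxx /b /=; lia.
split; first by rewrite szF; case: (boolP ((a, b) \in F)) => _ /=; lia.
move=> szL; have abF : (a, b) \in F.
  by move: szF; case: (boolP ((a, b) \in F)) => //= _ szF; lia.
rewrite abF in szF.
have [l szl El] := t1 ltac:(lia); have [r szr Er] := t2 ltac:(lia).
exists (Node l r); first by rewrite /=; lia.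
move=> p; rewrite inE mem_cat szl -eL1 -El -Er !mem_filter !inF' -andb_orl.
rewrite (_ : (p.2 <= m) || (m < p.2)); last by case: leqP.
rewrite /= szl szr (_ : a + _ = b); last by lia.
by case: (eqVneq p (a, b)) => [->|].
Qed.

Lemma diags_nodes a t : diags a t = [seq (p.1.1, p.2) | p <- nodes a t].
Proof. by elim: t a => //= l IHl r IHr a; rewrite map_cat IHl IHr. Qed.

Lemma uniq_nodes a t : uniq (nodes a t).
Proof. by apply: (@map_uniq _ _ (fun p => (p.1.1, p.2))); rewrite -diags_nodes uniq_diags. Qed.

Lemma edge_root a t : edge (diags a t) a (a + (tsize t).+1).
Proof. by case: t => [|l r]; rewrite /edge /= ?mem_head ?orbT // addn1 eqxx. Qed.

Lemma nodes_edges a t x m y : (x, m, y) \in nodes a t ->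
  [/\ x < m, m < y, (x, y) \in diags a t,
    edge (diags a t) x m & edge (diags a t) m y].
Proof.
have edgeS (F G : seq (nat * nat)) z u : {subset F <= G} -> edge F z u -> edge G z u.
  by move=> FG; rewrite /edge => /orP[->//|/FG ->]; rewrite orbT.
elim: t a => //= l IHl r IHr a; rewrite inE mem_cat.
case/or3P=> [/eqP[-> -> ->]|/IHl[? ? xy xm my]|/IHr[? ? xy xm my]].
- split; rewrite ?mem_head //; try lia.
    by apply: edgeS (edge_root a l) => p pl; rewrite inE mem_cat pl orbT.
  rewrite (_ : a + _.+2 = a + (tsize l).+1 + (tsize r).+1); last by lia.
  by apply: edgeS (edge_root _ r) => p pr; rewrite inE mem_cat pr !orbT.
- by split=> //; rewrite ?inE ?mem_cat ?xy ?orbT //; [apply: edgeS xm|apply: edgeS my];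
     move=> p pl; rewrite inE mem_cat pl orbT.
- by split=> //; rewrite ?inE ?mem_cat ?xy ?orbT //; [apply: edgeS xm|apply: edgeS my];
     move=> p pr; rewrite inE mem_cat pr !orbT.
Qed.

(** The chord [(x, y)] is the base of some node. If the apex of that node differed from [m], a side
    ending at one of the two apexes would cross a side at the other. *)
Lemma edges_nodes a t x m y : x < m -> m < y ->
  edge (diags a t) x m -> edge (diags a t) m y -> edge (diags a t) x y ->
  (x, m, y) \in nodes a t.
Proof.
move=> lt_xm lt_my xm my /orP[/eqP|]; first by lia.
rewrite diags_nodes => /mapP[[[x1 m1] y1] nd [/= ex ey]]; subst x1 y1.
have [? ? _ xm1 m1y] := nodes_edges nd.
have nc := noncross_edge (@noncross_diags a t).
have := nc _ _ _ _ xm1 my; have := nc _ _ _ _ xm m1y; rewrite /crosses /=.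
by case: (ltngtP m m1) => [||->//]; lia.
Qed.

(** Right subtrees start strictly after [a], so the nodes starting at [a] are those of the spine.
    The right subtree of [(a, m, y)] sits on [m, ..., y], and its size is [y - m - 1]. *)
Lemma spine_nodes a t :
  [seq p.2 - p.1.2.+1 | p <- nodes a t & p.1.1 == a] = spine t.
Proof.
have nodes_gt b r : a < b -> [seq p <- nodes b r | p.1.1 == a] = [::].
  move=> lt_ab; apply/eqP; rewrite -[_ == _]negbK -has_filter; apply/hasPn => -[[x m] y].
  by move=> /nodes_edges[_ _ /diags_bound[]]; rewrite /=; lia.
elim: t => //= l IHl r _; rewrite eqxx /= filter_cat map_cat IHl nodes_gt ?cats0; last by lia.
by congr (_ :: _); lia.
Qed.

End Chords.

Local Open Scope classical_set_scope.
Local Open Scope ring_scope.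

(** * Convexity of the vertex set *)

Section Geometry.
Set Implicit Arguments.
Unset Strict Implicit.
Variable R : realType.
Implicit Types p q r x : plane R.

(* Twice the signed area of the triangle p, q, r. *)
Definition ori p q r : R :=
  (q.1 - p.1) * (r.2 - p.2) - (q.2 - p.2) * (r.1 - p.1).

Lemma ori_cyc p q r : ori p q r = ori q r p.
Proof. by rewrite /ori; ring. Qed.

Lemma ori_swap p q r : ori q p r = - ori p q r.
Proof. by rewrite /ori; ring. Qed.

Lemma ori_id p q : ori p q p = 0.
Proof. by rewrite /ori; ring. Qed.

Lemma ori_id2 p q : ori p q q = 0.
Proof. by rewrite /ori; ring. Qed.

Definition pt (n k : nat) : plane R :=
  (cos (2 * pi * k%:R / n%:R), sin (2 * pi * k%:R / n%:R)).

(** Half the polar angle of [pt n k]: directions of chords and inscribed angles are sums and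
    differences of these. *)
Definition half_arg (n k : nat) : R := pi * k%:R / n%:R.

(** Sum-to-product formulas: with half angles [a] and [b] at its ends, the chord has signed length
    [2 sin (b - a)] and direction [a + b + pi / 2]. *)
Lemma vec_pt n i j : vec (pt n i) (pt n j) =
  (- (2 * sin (half_arg n j - half_arg n i) * sin (half_arg n i + half_arg n j)),
   2 * sin (half_arg n j - half_arg n i) * cos (half_arg n i + half_arg n j)).
Proof.
have dbl k : 2 * pi * k%:R / n%:R = half_arg n k + half_arg n k :> R.
  by rewrite /half_arg; ring.
rewrite /vec /pt !dbl /=; set a := half_arg n i; set b := half_arg n j.
have Ca := cos2Dsin2 a; have Cb := cos2Dsin2 b.
rewrite sinB !sinD !cosD; congr pair.
  transitivity (2 * (cos b ^+ 2 * (cos a ^+ 2 + sin a ^+ 2) -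
      cos a ^+ 2 * (cos b ^+ 2 + sin b ^+ 2))); last by ring.
  have sa2 : sin a ^+ 2 = 1 - cos a ^+ 2 by rewrite -Ca; ring.
  have sb2 : sin b ^+ 2 = 1 - cos b ^+ 2 by rewrite -Cb; ring.
  by rewrite Ca Cb -!expr2 sa2 sb2; ring.
transitivity (2 * (sin b * cos b * (cos a ^+ 2 + sin a ^+ 2) -
   sin a * cos a * (cos b ^+ 2 + sin b ^+ 2))); last by ring.
by rewrite Ca Cb; ring.
Qed.

Lemma half_argB n i j : (i <= j)%N -> half_arg n j - half_arg n i = half_arg n (j - i).
Proof. by move=> le_ij; rewrite /half_arg natrB //; ring. Qed.

Lemma half_arg_bound n k : (k < n)%N -> 0 <= half_arg n k < pi.
Proof.
move=> lt_kn; have n0 : 0 < n%:R :> R by rewrite ltr0n; lia.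
rewrite /half_arg ltr_pdivrMr // divr_ge0 ?mulr_ge0 ?pi_ge0 //=.
by rewrite ltr_pM2l ?pi_gt0 // ltr_nat.
Qed.

Lemma sin_half_arg_gt0 n k : (0 < k < n)%N -> 0 < sin (half_arg n k).
Proof.
case/andP=> k0 lt_kn; apply: sin_gt0_pi.
have /andP[_ ->] := half_arg_bound lt_kn; rewrite andbT.
by rewrite /half_arg divr_gt0 ?mulr_gt0 ?pi_gt0 ?ltr0n //; lia.
Qed.

(** The determinant is [4 sin (j - i) sin (k - i) sin (k - j)] in half angles, all of which lie
    strictly between 0 and [pi]. The separation and covering arguments draw the convexity of the
    polygon from this sign. *)
Lemma ori_pt_gt0 n i j k : (i < j)%N -> (j < k)%N -> (k < n)%N ->
  0 < ori (pt n i) (pt n j) (pt n k).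
Proof.
move=> lt_ij lt_jk lt_kn.
have -> : ori (pt n i) (pt n j) (pt n k) =
    (vec (pt n i) (pt n j)).1 * (vec (pt n i) (pt n k)).2 -
    (vec (pt n i) (pt n j)).2 * (vec (pt n i) (pt n k)).1 by [].
rewrite !vec_pt /= !half_argB; try lia.
set a := half_arg n i; set b := half_arg n j; set c := half_arg n k.
have -> : - (2 * sin (half_arg n (j - i)) * sin (a + b)) *
    (2 * sin (half_arg n (k - i)) * cos (a + c)) -
    2 * sin (half_arg n (j - i)) * cos (a + b) *
    - (2 * sin (half_arg n (k - i)) * sin (a + c)) =
    4 * sin (half_arg n (j - i)) * sin (half_arg n (k - i)) *
    sin ((a + c) - (a + b)) by rewrite [sin (_ - _)]sinB; ring.
have -> : (a + c) - (a + b) = c - b by ring.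
rewrite half_argB; last by lia.
by rewrite !mulr_gt0 ?sin_half_arg_gt0 //; lia.
Qed.

Lemma ori_pt_in n a b c : (a <= c <= b)%N -> (b < n)%N ->
  0 <= ori (pt n b) (pt n a) (pt n c).
Proof.
case/andP; rewrite leq_eqVlt => /orP[/eqP<- _ _|lt_ac]; first by rewrite ori_id2.
rewrite leq_eqVlt => /orP[/eqP-> _|lt_cb lt_bn]; first by rewrite ori_id.
by rewrite ori_cyc ltW // ori_pt_gt0.
Qed.

Lemma ori_pt_out n a b c : (a < b < n)%N -> (c < n)%N -> ~~ (a < c < b)%N ->
  0 <= ori (pt n a) (pt n b) (pt n c).
Proof.
case/andP=> lt_ab lt_bn lt_cn; rewrite negb_and -!leqNgt => /orP[].
  rewrite leq_eqVlt => /orP[/eqP->|lt_ca]; first by rewrite ori_id.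
  by rewrite -ori_cyc ltW // ori_pt_gt0.
rewrite leq_eqVlt => /orP[/eqP->|lt_bc]; first by rewrite ori_id2.
by rewrite ltW // ori_pt_gt0.
Qed.

(** * Hulls of vertex sets and separating lines *)

Section Hull.
Variable n : nat.
Implicit Types s t : {set 'I_n}.

Lemma vertex_pt (i : 'I_n) : vertex R i = pt n i.
Proof. by []. Qed.

Lemma ori_sum p q s (w : 'I_n -> R) : \sum_(i in s) w i = 1 ->
  ori p q (\sum_(i in s) w i * (vertex R i).1, \sum_(i in s) w i * (vertex R i).2)
  = \sum_(i in s) w i * ori p q (vertex R i).
Proof.
move=> w1; rewrite /ori /=.
transitivity ((q.1 - p.1) * \sum_(i in s) w i * (vertex R i).2
  - (q.2 - p.2) * \sum_(i in s) w i * (vertex R i).1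
  + (q.2 * p.1 - q.1 * p.2) * \sum_(i in s) w i).
  by rewrite w1; ring.
rewrite !mulr_sumr -sumrB -big_split /=.
by apply: eq_bigr => i _; ring.
Qed.

Lemma ori_hull_ge0 p q s x : hull R s x ->
  (forall i, i \in s -> 0 <= ori p q (vertex R i)) -> 0 <= ori p q x.
Proof.
case=> w [w_ge0 w1 ->] s_ge0; rewrite ori_sum // sumr_ge0 // => i si.
by rewrite mulr_ge0 ?w_ge0 ?s_ge0.
Qed.

Lemma open_hullW s x : open_hull R s x -> hull R s x.
Proof. by case=> w [w_gt0 w1 ->]; exists w; split=> // i /w_gt0/ltW. Qed.

Lemma ori_open_hull_gt0 p q s x : open_hull R s x ->
  (forall i, i \in s -> 0 <= ori p q (vertex R i)) ->
  (exists2 i, i \in s & 0 < ori p q (vertex R i)) -> 0 < ori p q x.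
Proof.
case=> w [w_gt0 w1 ->] s_ge0 [i si i_gt0]; rewrite ori_sum // (bigD1 i) //=.
rewrite ltr_pwDl ?mulr_gt0 ?w_gt0 // sumr_ge0 // => j /andP[sj _].
by rewrite mulr_ge0 ?s_ge0 // ltW ?w_gt0.
Qed.

(** The weights of an open hull are positive, so a single vertex strictly on its side of the line
    [pq] moves the whole open hull off the line. Without such a vertex both sets could lie on the
    line and meet. *)
Lemma open_hull_separated p q s t :
  (forall i, i \in s -> 0 <= ori p q (vertex R i)) ->
  (forall i, i \in t -> 0 <= ori q p (vertex R i)) ->
  (exists2 i, i \in s & 0 < ori p q (vertex R i)) \/
  (exists2 i, i \in t & 0 < ori q p (vertex R i)) ->
  open_hull R s `&` open_hull R t = set0.
Proof.
move=> s_ge0 t_ge0 strict; apply/seteqP; split=> // x [/= sx tx].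
have := ori_hull_ge0 (open_hullW sx) s_ge0.
have := ori_hull_ge0 (open_hullW tx) t_ge0.
rewrite ori_swap oppr_ge0 => le0 ge0.
case: strict => [|] => [/(ori_open_hull_gt0 sx s_ge0)|/(ori_open_hull_gt0 tx t_ge0)].
  by rewrite ltNge le0.
by rewrite ori_swap oppr_gt0 ltNge ge0.
Qed.

Lemma big_set2 (T : nmodType) (a b : 'I_n) (F : 'I_n -> T) : a != b ->
  \sum_(i in [set a; b]%SET) F i = F a + F b.
Proof. by move=> ab; rewrite big_setU1 ?inE //= big_set1. Qed.

Lemma open_hull_crossing (a b c d : 'I_n) : crosses (val a, val b) (val c, val d) ->
  open_hull R [set a; b]%SET `&` open_hull R [set c; d]%SET !=set0.
Proof.
case/and3P=> /= lt_ac lt_cb lt_bd; have lt_dn := ltn_ord d.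
pose A := vertex R a; pose B := vertex R b; pose C := vertex R c; pose D := vertex R d.
have wa : 0 < ori C B D by apply: ori_pt_gt0.
have wb : 0 < ori A C D by apply: ori_pt_gt0; rewrite // (ltn_trans lt_cb).
have wc : 0 < ori A B D by apply: ori_pt_gt0; rewrite // (ltn_trans lt_ac).
have wd : 0 < ori A C B by apply: ori_pt_gt0; rewrite // (ltn_trans lt_bd).
(* The coefficients of the affine dependency between A, B and C, D. *)
have eS : ori C B D + ori A C D = ori A B D + ori A C B by rewrite /ori; ring.
pose S := ori C B D + ori A C D; have S_gt0 : 0 < S by rewrite addr_gt0.
have S_neq0 : S != 0 by rewrite gt_eqF.
have ab : a != b by rewrite -val_eqE /= neq_ltn (ltn_trans lt_ac lt_cb).
have cd : c != d by rewrite -val_eqE /= neq_ltn (ltn_trans lt_cb lt_bd).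
exists ((ori C B D / S * A.1 + ori A C D / S * B.1),
        (ori C B D / S * A.2 + ori A C D / S * B.2)); split.
  exists (fun i => if i == a then ori C B D / S else ori A C D / S).
  rewrite !big_set2 // eqxx eq_sym (negbTE ab); split=> //.
    by move=> i _; case: ifP => _; apply: divr_gt0.
  by rewrite -mulrDl divff.
exists (fun i => if i == c then ori A B D / S else ori A C B / S).
rewrite !big_set2 // eqxx eq_sym (negbTE cd); split=> //.
- by move=> i _; case: ifP => _; apply: divr_gt0.
- by rewrite -mulrDl -eS divff.
by rewrite -/C -/D; congr pair; rewrite !(mulrAC _ S^-1) -!mulrDl;
  congr (_ / _); rewrite /ori; ring.
Qed.

(** The line through [a] and [b] separates: without crossings [c] and [d] are weakly on one side of
    it, and since the chords differ one of them is strictly there. *)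
Lemma open_hull_noncrossing (a b c d : 'I_n) : (a < b)%N -> (c < d)%N ->
  (a, b) != (c, d) ->
  ~~ crosses (val a, val b) (val c, val d) ->
  ~~ crosses (val c, val d) (val a, val b) ->
  open_hull R [set a; b]%SET `&` open_hull R [set c; d]%SET = set0.
Proof.
rewrite xpair_eqE -!val_eqE /crosses /= => lt_ab lt_cd neq ncr1 ncr2.
have lt_bn := ltn_ord b; have lt_dn := ltn_ord d.
case: (boolP (a <= c <= b)%N) => cab; last first.
  have dab : ~~ (a < d < b)%N by lia.
  rewrite setIC; apply: (@open_hull_separated (vertex R a) (vertex R b)).
  - by move=> i /set2P[]->; apply: ori_pt_out => //; lia.
  - by move=> i /set2P[]->; rewrite ?ori_id ?ori_id2.
  left; exists c; first by rewrite !inE eqxx.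
  case: (ltnP c a) => ca; first by rewrite -ori_cyc; apply: ori_pt_gt0.
  by apply: ori_pt_gt0 => //; lia.
case: (ltnP b d) => bd.
  have dab : ~~ (a < d < b)%N by lia.
  rewrite setIC; apply: (@open_hull_separated (vertex R a) (vertex R b)).
  - by move=> i /set2P[]->; apply: ori_pt_out => //; lia.
  - by move=> i /set2P[]->; rewrite ?ori_id ?ori_id2.
  by left; exists d; [rewrite !inE eqxx orbT|apply: ori_pt_gt0].
rewrite setIC; apply: (@open_hull_separated (vertex R b) (vertex R a)).
- by move=> i /set2P[]->; apply: ori_pt_in => //; lia.
- by move=> i /set2P[]->; rewrite ?ori_id ?ori_id2.
left; case: (ltnP a c) => ac.
  by exists c; [rewrite !inE eqxx|rewrite ori_cyc; apply: ori_pt_gt0 => //; lia].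
by exists d; [rewrite !inE eqxx orbT|rewrite ori_cyc; apply: ori_pt_gt0 => //; lia].
Qed.

(** The vertex [z] lies in one of the three arcs cut out by [x], [m], [y]. As no edges cross, all of
    [u] lies in that closed arc, and the side spanning it separates, strictly at the opposite vertex
    of the triangle. *)
Lemma open_hull_triangles (x m y z : 'I_n) (u : {set 'I_n}) :
  (x < m)%N -> (m < y)%N -> z \in u -> z \notin [set x; m; y]%SET ->
  (forall a b c d, a \in [set x; m; y]%SET -> b \in [set x; m; y]%SET ->
     c \in u -> d \in u ->
     ~~ crosses (val a, val b) (val c, val d) &&
     ~~ crosses (val c, val d) (val a, val b)) ->
  open_hull R [set x; m; y]%SET `&` open_hull R u = set0.
Proof.
move=> lt_xm lt_my uz; rewrite !inE !negb_or -!val_eqE /= => /andP[/andP[zx zm] zy] nc.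
have lt_yn := ltn_ord y; have lt_zn := ltn_ord z.
have lt_mn := ltn_ord m.
have xs : x \in [set x; m; y]%SET by rewrite !inE eqxx.
have ms : m \in [set x; m; y]%SET by rewrite !inE eqxx orbT.
have ys : y \in [set x; m; y]%SET by rewrite !inE eqxx orbT.
have nc' a b i : a \in [set x; m; y]%SET -> b \in [set x; m; y]%SET ->
    i \in u -> [&& ~~ ((a < i < b) && (b < z))%N, ~~ ((i < a < z) && (z < b))%N,
      ~~ ((a < z < b) && (b < i))%N & ~~ ((z < a < i) && (i < b))%N].
  move=> sa sb ui; move: (nc a b i z sa sb ui uz) (nc a b z i sa sb uz ui).
  by rewrite /crosses /=; lia.
have in_s (P : 'I_n -> Prop) : P x -> P m -> P y ->
    forall i, i \in [set x; m; y]%SET -> P i.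
  by move=> ? ? ? i; rewrite !inE => /orP[/orP[]|] /eqP->.
case: (boolP (x < z < m)%N) => zxm.
  apply: (@open_hull_separated (vertex R x) (vertex R m)).
  - by apply: in_s; apply: ori_pt_out; lia.
  - move=> i ui; apply: ori_pt_in => //.
    by move: (nc' x m i xs ms ui); lia.
  by left; exists y => //; apply: ori_pt_gt0.
case: (boolP (m < z < y)%N) => zmy.
  apply: (@open_hull_separated (vertex R m) (vertex R y)).
  - by apply: in_s; apply: ori_pt_out; lia.
  - move=> i ui; apply: ori_pt_in => //.
    by move: (nc' m y i ms ys ui); lia.
  by left; exists x => //; rewrite -ori_cyc; apply: ori_pt_gt0.
apply: (@open_hull_separated (vertex R y) (vertex R x)).
- by apply: in_s; apply: ori_pt_in; lia.
- move=> i ui; apply: ori_pt_out => //; first by lia.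
  by move: (nc' x y i xs ys ui); lia.
by left; exists m => //; rewrite ori_cyc; apply: ori_pt_gt0.
Qed.

(** The weights are the barycentric coordinates of [x], that is, ratios of signed areas. *)
Lemma hull_triangle (a b c : 'I_n) x :
  0 < ori (vertex R a) (vertex R b) (vertex R c) ->
  0 <= ori (vertex R a) (vertex R b) x ->
  0 <= ori (vertex R b) (vertex R c) x ->
  0 <= ori (vertex R c) (vertex R a) x ->
  hull R [set a; b; c]%SET x.
Proof.
set A := vertex R a; set B := vertex R b; set C := vertex R c => S_gt0 ge_c ge_a ge_b.
have S_neq0 : ori A B C != 0 by rewrite gt_eqF.
have ab : a != b by apply: contraNneq S_neq0 => eab; rewrite /A eab /ori subrr; apply/eqP; ring.
have ac : a != c by apply: contraNneq S_neq0 => eac; rewrite /A eac ori_id.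
have bc : b != c by apply: contraNneq S_neq0 => ebc; rewrite /B ebc ori_id2.
exists (fun i => (if i == a then ori B C x else if i == b then ori C A x else ori A B x)
   / ori A B C).
have big3 (F : 'I_n -> R) : \sum_(i in [set a; b; c]%SET) F i = F a + F b + F c.
  by rewrite -finset.setUA big_setU1 ?inE ?negb_or ?ab //= big_set2 // addrA.
rewrite !big3 eqxx ![b == a]eq_sym ![c == _]eq_sym (negbTE ab) (negbTE ac) (negbTE bc) eqxx.
split.
- by move=> i _; apply: divr_ge0; [case: ifP => _ //; case: ifP|exact: ltW].
- rewrite -!mulrDl -[RHS](divff S_neq0); congr (_ / _); rewrite /ori; ring.
rewrite -/A -/B -/C; case: x {ge_a ge_b ge_c} => x1 x2.
congr pair; apply: (mulIf S_neq0); rewrite !(mulrAC _ (ori A B C)^-1) -!mulrDl;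
  rewrite mulfVK //; rewrite /ori /=; ring.
Qed.

End Hull.

(* If x is not in the triangle of the root, it lies beyond one of its two upper
   sides, hence in the part of the polygon carried by that subtree. *)
Lemma cover_nodes n a t x : (0 < tsize t)%N ->
  (forall i, (a <= i < a + (tsize t).+1)%N -> 0 <= ori (pt n i) (pt n i.+1) x) ->
  0 <= ori (pt n (a + (tsize t).+1)) (pt n a) x ->
  exists i m j, [/\ (i, m, j) \in nodes a t, 0 <= ori (pt n i) (pt n m) x,
    0 <= ori (pt n m) (pt n j) x & 0 <= ori (pt n j) (pt n i) x].
Proof.
elim: t a => // l IHl r IHr a _ sides base.
set m := (a + (tsize l).+1)%N.
have eb : (a + (tsize (Node l r)).+1 = m + (tsize r).+1)%N by rewrite /m /=; lia.
case: (leP 0 (ori (pt n a) (pt n m) x)) => am; last first.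
  have l_gt0 : (0 < tsize l)%N.
    rewrite lt0n; apply: contraTneq am => l0.
    by rewrite -leNgt /m l0 addn1 sides //; lia.
  have [||i [k [j [ikj ? ? ?]]]] := IHl a l_gt0.
  - by move=> i Hi; apply: sides => /=; lia.
  - by rewrite ori_swap oppr_ge0 ltW.
  by exists i, k, j; split=> //; rewrite inE mem_cat ikj orbT.
case: (leP 0 (ori (pt n m) (pt n (m + (tsize r).+1)) x)) => mb; last first.
  have r_gt0 : (0 < tsize r)%N.
    rewrite lt0n; apply: contraTneq mb => r0.
    by rewrite -leNgt r0 addn1 sides // eb r0 /m; lia.
  have [||i [k [j [ikj ? ? ?]]]] := IHr m r_gt0.
  - by move=> i Hi; apply: sides; rewrite eb /m; lia.
  - by rewrite ori_swap oppr_ge0 ltW.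
  by exists i, k, j; split=> //; rewrite inE mem_cat ikj !orbT.
by exists a, m, (m + (tsize r).+1)%N; split=> //; rewrite -?eb // mem_head.
Qed.

(** * The inscribed angle at the first vertex *)

Lemma angleC p q r : angle p q r = angle p r q.
Proof. by rewrite /angle /dot; congr (acos (_ / _)); ring. Qed.

(** As [half_arg n 0] vanishes, the chord from vertex 0 to [k] has direction
    [half_arg n k + pi / 2]. The angle is thus a difference of half angles, and it lies in
    [[0, pi]], where [acos] inverts [cos]. *)
Lemma angle_pt0 n b c : (0 < b)%N -> (b < c)%N -> (c < n)%N ->
  angle (pt n 0) (pt n b) (pt n c) = pi * (c - b)%:R / n%:R.
Proof.
move=> b_gt0 lt_bc lt_cn.
have arg0 : half_arg n 0 = 0 by rewrite /half_arg mulr0 mul0r.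
have vec0 k : vec (pt n 0) (pt n k) =
    (- (2 * sin (half_arg n k) * sin (half_arg n k)),
     2 * sin (half_arg n k) * cos (half_arg n k)).
  by rewrite vec_pt arg0 subr0 add0r.
have norm0 k : (0 < k < n)%N -> enorm (vec (pt n 0) (pt n k)) = 2 * sin (half_arg n k).
  move=> /sin_half_arg_gt0 k_gt0; rewrite /enorm vec0 /dot /=.
  set s := sin _; set c0 := cos _.
  have -> : - (2 * s * s) * - (2 * s * s) + 2 * s * c0 * (2 * s * c0) =
     (2 * s) ^+ 2 * (c0 ^+ 2 + s ^+ 2) by ring.
  by rewrite cos2Dsin2 mulr1 sqrtr_sqr ger0_norm // mulr_ge0 // ltW.
rewrite /angle !norm0 ?vec0; try lia.
have sb := @sin_half_arg_gt0 n b ltac:(lia).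
have sc := @sin_half_arg_gt0 n c ltac:(lia).
have -> : dot (- (2 * sin (half_arg n b) * sin (half_arg n b)),
     2 * sin (half_arg n b) * cos (half_arg n b))
   (- (2 * sin (half_arg n c) * sin (half_arg n c)),
     2 * sin (half_arg n c) * cos (half_arg n c)) =
   cos (half_arg n c - half_arg n b) *
     (2 * sin (half_arg n b) * (2 * sin (half_arg n c))).
  by rewrite /dot /= cosB; ring.
rewrite mulfK; last by rewrite !mulf_neq0 ?gt_eqF // pnatr_eq0.
rewrite half_argB; last by lia.
have /andP[ge0 ltpi] := @half_arg_bound n (c - b) ltac:(lia).
by rewrite cosK // in_itv /= ge0 ltW.
Qed.

End Geometry.

(** * Triangulations and trees *)

Section Pairs.
Local Open Scope nat_scope.
Set Implicit Arguments.
Unset Strict Implicit.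

Lemma enum_ord_sorted n (A : {set 'I_n}) : sorted ltn (map val (enum A)).
Proof.
apply: (subseq_sorted ltn_trans _ (iota_ltn_sorted 0 n)).
by rewrite -val_enum_ord map_subseq // enumT filter_subseq.
Qed.

Lemma set_of_enum n (A : {set 'I_n}) : A = [set:: enum A]%SET.
Proof. by apply/setP => x; rewrite !inE mem_enum. Qed.

Lemma set2_sorted n (A : {set 'I_n}) : #|A| = 2 ->
  exists i j : 'I_n, i < j /\ A = [set i; j]%SET.
Proof.
rewrite cardE => sz; have := enum_ord_sorted A; have := set_of_enum A.
case: (enum A) sz => [|i [|j []]] //= _ eA; rewrite andbT => lt_ij.
by exists i, j; split=> //; rewrite eA; apply/setP => x; rewrite !inE.
Qed.

Lemma set3_sorted n (A : {set 'I_n}) : #|A| = 3 ->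
  exists i j k : 'I_n, [/\ i < j, j < k & A = [set i; j; k]%SET].
Proof.
rewrite cardE => sz; have := enum_ord_sorted A; have := set_of_enum A.
case: (enum A) sz => [|i [|j [|k []]]] //= _ eA; rewrite andbT => /andP[lt_ij lt_jk].
by exists i, j, k; split=> //; rewrite eA; apply/setP => x; rewrite !inE orbA.
Qed.

Lemma set2_inj n (i j k l : 'I_n) : i < j -> k < l ->
  [set i; j]%SET = [set k; l]%SET -> (i, j) = (k, l).
Proof.
move=> lt_ij lt_kl /setP E.
move: (E i) (E j) (E k) (E l); rewrite !inE !eqxx ?orbT -!val_eqE /= => Ei Ej Ek El.
by congr pair; apply: val_inj => /=; lia.
Qed.

Lemma set3_inj n (i j k i' j' k' : 'I_n) : i < j -> j < k -> i' < j' -> j' < k' ->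
  [set i; j; k]%SET = [set i'; j'; k']%SET -> (i, j, k) = (i', j', k').
Proof.
move=> lt_ij lt_jk lt_ij' lt_jk' /setP E.
move: (E i) (E j) (E k) (E i') (E j') (E k').
rewrite !inE !eqxx ?orbT -!val_eqE /= => *.
by congr (_, _, _); apply: val_inj => /=; lia.
Qed.

Lemma card_set_seq (T : finType) (s : seq T) : uniq s -> #|[set:: s]%SET| = size s.
Proof. by move=> us; rewrite cardsE; apply/card_uniqP. Qed.

Lemma side_pair N (i j : 'I_N.+2) : i < j ->
  is_side [set i; j]%SET = (j == i.+1 :> nat) || (i == 0 :> nat) && (j == N.+1 :> nat).
Proof.
move=> lt_ij; apply/existsP/orP => [[k /eqP]|].
  case: (ltnP k.+1 N.+2) => [lt_k|le_k].
    have eS : ordS k = k.+1 :> nat by rewrite /= modn_small.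
    have lt_kS : k < ordS k by rewrite eS.
    by move=> /(set2_inj lt_ij lt_kS)[-> ->]; rewrite eS eqxx; left.
  have eS : ordS k = 0 :> nat.
    by rewrite /= (_ : k.+1 = N.+2) ?modnn //; have := ltn_ord k; lia.
  have lt_Sk : ordS k < k by rewrite eS; lia.
  rewrite (finset.setUC [set k]%SET) => /(set2_inj lt_ij lt_Sk)[-> ->]; rewrite eS.
  by right; have := ltn_ord k; lia.
case=> [/eqP ej|/andP[/eqP i0 /eqP ej]].
  exists i; apply/eqP; congr [set _; _]%SET; apply: val_inj.
  by rewrite /= modn_small -ej.
exists j; apply/eqP; rewrite (finset.setUC [set j]%SET); congr [set _; _]%SET; apply: val_inj.
by rewrite /= ej modnn.
Qed.

End Pairs.

Section Triangulations.
Set Implicit Arguments.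
Unset Strict Implicit.
Variables (R : realType) (N : nat).
Hypothesis N_gt0 : (0 < N)%N.
Local Notation n := N.+2.

Definition chord (p : nat * nat) : {set 'I_n} := [set inord p.1; inord p.2]%SET.

(** The outermost base is a side of the polygon, so it is removed; [N - 1 = n - 3] diagonals remain
    when [t] has [N] nodes. *)
Definition dissection (t : tree) : {set {set 'I_n}} :=
  [set:: [seq chord p | p <- diags 0 t & p != (0, N.+1)]]%SET.

Definition valid (p : nat * nat) := (p.1 < p.2 < n)%N.

Lemma chordE p : p \in valid -> exists i j : 'I_n,
  [/\ (i < j)%N, p = (val i, val j) & chord p = [set i; j]%SET].
Proof.
case: p => x y; rewrite unfold_in /= => /andP[lt_xy lt_yn].
by exists (inord x), (inord y); rewrite /= !inordK //; lia.
Qed.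

Lemma chord_inj : {in valid &, injective chord}.
Proof.
move=> p q /chordE[i [j [lt_ij -> ->]]] /chordE[k [l [lt_kl -> ->]]].
by case/(set2_inj lt_ij lt_kl) => -> ->.
Qed.

Lemma chord_val (i j : 'I_n) : chord (val i, val j) = [set i; j]%SET.
Proof. by rewrite /chord /= !inord_val. Qed.

Lemma diags_valid t : tsize t = N -> {subset diags 0 t <= valid}.
Proof.
by move=> sz [x y] /diags_bound[_ ? ?]; rewrite unfold_in /=; lia.
Qed.

Lemma root_diags t : tsize t = N -> (0, N.+1)%N \in diags 0 t.
Proof.
by move=> sz; have := edge_root 0 t; rewrite sz /edge add0n => /orP[/eqP|//]; lia.
Qed.

Lemma mem_dissection t (i j : 'I_n) : tsize t = N -> (i < j)%N ->
  ([set i; j]%SET \in dissection t) =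
  ((val i, val j) != (0, N.+1)%N) && ((val i, val j) \in diags 0 t).
Proof.
move=> sz lt_ij; rewrite !inE -chord_val.
apply/mapP/idP => [[q]|H]; last by exists (val i, val j); rewrite ?mem_filter.
rewrite mem_filter => /andP[q0 qt] /chord_inj ->; rewrite ?q0 //.
  by rewrite unfold_in /= lt_ij ltn_ord.
exact: (diags_valid sz).
Qed.

Lemma dissection_diagonal t e : tsize t = N -> e \in dissection t ->
  is_diagonal e /\ exists i j : 'I_n, [/\ (i < j)%N, e = [set i; j]%SET &
    (val i, val j) \in diags 0 t].
Proof.
move=> sz; rewrite inE => /mapP[p]; rewrite mem_filter => /andP[p0 pt ->].
have [i [j [lt_ij ep ->]]] := chordE (diags_valid sz pt); subst p.
have [_ gap _] := diags_bound pt.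
split; last by exists i, j.
rewrite /is_diagonal side_pair // cards2 -val_eqE.
by move: p0 gap lt_ij; rewrite xpair_eqE /=; case: (ltngtP i j) => //=; lia.
Qed.

(** The chord [(0, N.+1)] missing from [dissection] comes back as the side through the wrap-around
    of [ordS]. *)
Lemma edge_pair t (i j : 'I_n) : tsize t = N -> (i < j)%N ->
  is_side [set i; j]%SET || ([set i; j]%SET \in dissection t) = edge (diags 0 t) i j.
Proof.
move=> sz lt_ij; rewrite side_pair // mem_dissection // xpair_eqE /edge /=.
case: (boolP ((i == 0 :> nat) && (j == N.+1 :> nat))) => [/andP[/eqP-> /eqP->]|_] /=.
  by rewrite root_diags // !orbT.
by rewrite orbF.
Qed.

Definition triangle (p : nat * nat * nat) : {set 'I_n} :=
  [set inord p.1.1; inord p.1.2; inord p.2]%SET.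

Lemma triangle_val (i j k : 'I_n) : triangle (val i, val j, val k) = [set i; j; k]%SET.
Proof. by rewrite /triangle /= !inord_val. Qed.

Lemma triangleE t p : tsize t = N -> p \in nodes 0 t -> exists i j k : 'I_n,
  [/\ (i < j)%N, (j < k)%N, p = (val i, val j, val k) & triangle p = [set i; j; k]%SET].
Proof.
case: p => [[x m] y] sz /nodes_edges[lt_xm lt_my /diags_bound[_ _ le_y] _ _].
by exists (inord x), (inord m), (inord y); rewrite /= !inordK //; lia.
Qed.

Lemma triangle_edge t s (a b : 'I_n) : tsize t = N -> s \in triangles (dissection t) ->
  a \in s -> b \in s -> (a < b)%N -> edge (diags 0 t) a b.
Proof.
move=> sz; rewrite inE => /andP[_ /forall_inP H] sa sb lt_ab; rewrite -edge_pair //.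
have /forall_inP/(_ b sb)/implyP := H a sa; apply.
by rewrite neq_ltn lt_ab.
Qed.

Lemma mem_triangles t (i j k : 'I_n) : tsize t = N -> (i < j)%N -> (j < k)%N ->
  ([set i; j; k]%SET \in triangles (dissection t)) =
  ((val i, val j, val k) \in nodes 0 t).
Proof.
move=> sz lt_ij lt_jk; have lt_ik := ltn_trans lt_ij lt_jk.
have card3 : #|[set i; j; k]%SET| = 3.
  rewrite -finset.setUA cardsU1 cards2 !inE -!val_eqE /=; lia.
apply/idP/idP => [H|/nodes_edges[_ _ ik ij jk]].
  by apply: edges_nodes => //; apply: (triangle_edge sz H) => //; rewrite !inE eqxx ?orbT.
rewrite inE card3 /=.
have {}ik : edge (diags 0 t) i k by rewrite /edge ik orbT.
apply/forall_inP => a sa; apply/forall_inP => b sb; apply/implyP => ab.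
wlog lt_ab : a b sa sb ab / (a < b)%N.
  move=> W; have := ab; rewrite neq_ltn => /orP[|lt_ba]; first exact: W.
  by rewrite finset.setUC; apply: W => //; rewrite eq_sym.
rewrite edge_pair //; move: sa sb lt_ab ab; rewrite !inE.
by move=> /orP[/orP[]|] /eqP-> /orP[/orP[]|] /eqP->; rewrite ?eqxx // => lt_ab _; lia.
Qed.

Lemma triangle_inj t : tsize t = N -> {in nodes 0 t &, injective triangle}.
Proof.
move=> sz p q /(triangleE sz)[i [j [k [ij jk -> ->]]]]
  /(triangleE sz)[i' [j' [k' [ij' jk' -> ->]]]].
by case/(set3_inj ij jk ij' jk') => -> -> ->.
Qed.

Lemma trianglesE t : tsize t = N ->
  triangles (dissection t) = [set:: map triangle (nodes 0 t)]%SET.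
Proof.
move=> sz; apply/setP => s; rewrite [RHS]inE; apply/idP/mapP => [s_tri|[p pt ->]].
  have /set3_sorted[i [j [k [ij jk es]]]] : #|s| = 3.
    by move: s_tri; rewrite inE => /andP[/eqP].
  exists (val i, val j, val k); last by rewrite triangle_val.
  by rewrite -mem_triangles // -es.
have [i [j [k [ij jk ep ->]]]] := triangleE sz pt.
by rewrite mem_triangles // -ep.
Qed.

Lemma card_triangles t : tsize t = N -> #|triangles (dissection t)| = N.
Proof.
move=> sz; rewrite trianglesE // card_set_seq.
  by rewrite size_map -(size_map (fun p => (p.1.1, p.2))) -diags_nodes size_diags.
by rewrite map_inj_in_uniq ?uniq_nodes //; apply: triangle_inj.
Qed.

Lemma dissection_triangulation t : tsize t = N -> is_triangulation R (dissection t).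
Proof.
move=> sz; split.
- by move=> e /(dissection_diagonal sz)[].
- rewrite card_set_seq.
    rewrite size_map -rem_filter ?uniq_diags // size_rem ?root_diags //.
    by rewrite size_diags sz; lia.
  rewrite map_inj_in_uniq ?filter_uniq ?uniq_diags // => p q.
  rewrite !mem_filter => /andP[_ /(diags_valid sz) pv] /andP[_ /(diags_valid sz) qv].
  exact: chord_inj.
- move=> e f /(dissection_diagonal sz)[_ [i [j [ij -> ijt]]]].
  move=> /(dissection_diagonal sz)[_ [k [l [kl -> klt]]]] neq.
  apply: open_hull_noncrossing => //; try exact: (@noncross_diags 0 t).
  by apply: contraNneq neq => -[-> ->].
- by rewrite card_triangles //; lia.
split.
  apply/seteqP; split=> [x xP|x [s _ [w [w_ge0 w1 ->]]]].
    have x_in := ori_hull_ge0 xP.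
    have [|i i_lt| |i [m [j [nd ? ? ?]]]] := @cover_nodes R n 0 t x.
    - by rewrite sz.
    - by apply: x_in => k _; apply: ori_pt_out; rewrite ?ltn_ord //; lia.
    - by apply: x_in => k _; apply: ori_pt_in; rewrite ?sz //; have := ltn_ord k; lia.
    have [i' [m' [j' [im mj [ei em ej] etri]]]] := triangleE sz nd; subst i m j.
    exists (triangle (val i', val m', val j')).
      by rewrite /= trianglesE // inE map_f.
    by rewrite etri; apply: hull_triangle => //; apply: ori_pt_gt0.
  (* A point of one triangle gets weight 0 at all other vertices of the polygon. *)
  have sum_s (F : 'I_n -> R) :
      \sum_(i in [set: 'I_n]%SET) (if i \in s then F i else 0) = \sum_(i in s) F i.
    by rewrite -big_mkcondr; apply: eq_bigl => i; rewrite inE.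
  exists (fun i => if i \in s then w i else 0); split.
  - by move=> i _; case: ifP => // /w_ge0.
  - by rewrite sum_s.
  - by congr pair; rewrite -sum_s; apply: eq_bigr => i _; case: ifP => // _; rewrite mul0r.
move=> s u s_tri u_tri neq.
have cs : #|s| = 3 by move: s_tri; rewrite inE => /andP[/eqP].
have cu : #|u| = 3 by move: u_tri; rewrite inE => /andP[/eqP].
have [z uz zs] : exists2 z, z \in u & z \notin s.
  by apply/subsetPn; apply: contraNN neq => us; rewrite eq_sym eqEcard us cs cu.
have [i [j [k [ij jk es]]]] := set3_sorted cs; rewrite es in s_tri zs *.
apply: (@open_hull_triangles R n i j k z) => // a b c d sa sb uc ud.
have lt_crosses x y x' y' : crosses (x, y) (x', y') -> (x < y)%N /\ (x' < y')%N.
  by rewrite /crosses /=; lia.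
apply/andP; split; apply/negP => cr; have [? ?] := lt_crosses _ _ _ _ cr;
  move: cr; apply/negP; apply: (noncross_edge (@noncross_diags 0 t));
  by [apply: (triangle_edge sz s_tri)|apply: (triangle_edge sz u_tri)].
Qed.


(** Together with the base, the [N - 1] diagonals are [N] chords on the vertices [0, ..., N + 1],
    the extremal case of [noncross_max]. Crossing index pairs are excluded because their open
    segments would meet. *)
Lemma triangulation_dissection (D : {set {set 'I_n}}) : is_triangulation R D ->
  exists2 t, t \in trees N & D = dissection t.
Proof.
case=> diag cD ncD _ _.
have diagE e : e \in D -> exists i j : 'I_n, [/\ (i < j)%N, e = [set i; j]%SET &
    ~~ is_side [set i; j]%SET].
  move=> /diag/andP[/eqP/set2_sorted[i [j [ij ->]]] nside].
  by exists i, j.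
pose F : seq (nat * nat) := [seq p <- [seq (x, y) | x <- iota 0 n, y <- iota 0 n]
  | (p.1 < p.2)%N && (chord p \in D)].
have memF p : (p \in F) = (p \in valid) && (chord p \in D).
  case: p => x y; rewrite mem_filter.
  have -> : ((x, y) \in [seq (x, y) | x <- iota 0 n, y <- iota 0 n]) = (x < n)%N && (y < n)%N.
    apply/allpairsP/idP => [[[u v] []]|xy].
      by rewrite !mem_iota /= => xn yn [-> ->]; rewrite xn yn.
    by exists (x, y); rewrite !mem_iota; split=> //; case/andP: xy.
  by rewrite [_ \in valid]unfold_in /=; case: (chord _ \in D); lia.
have uF : uniq F.
  by rewrite filter_uniq // allpairs_uniq ?iota_uniq // => -[? ?] [? ?] _ _ [-> ->].
have ucF : uniq (map (chord) F).
  rewrite map_inj_in_uniq // => p q; rewrite !memF => /andP[pv _] /andP[qv _].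
  exact: chord_inj.
have szF : size F = N.-1.
  rewrite -(size_map (chord)) -(card_uniqP ucF) (_ : N.-1 = #|D|); last by rewrite cD; lia.
  apply: eq_card => e; apply/mapP/idP => [[p + ->]|eD]; first by rewrite memF => /andP[].
  have [i [j [ij ee _]]] := diagE e eD.
  exists (val i, val j); last by rewrite chord_val.
  by rewrite memF unfold_in /= ij ltn_ord chord_val -ee.
have gapF x y : (x, y) \in F -> [/\ x.+1 < y, y <= N.+1 & (x, y) != (0, N.+1)]%N.
  rewrite memF => /andP[/chordE[i [j [ij [-> ->] ->]]] /diagE[i' [j' [ij' E]]]].
  have [<- <-] := set2_inj ij ij' E.
  rewrite side_pair // xpair_eqE negb_or /= => /andP[? ?].
  by have := ltn_ord j; split=> //; lia.
have ncF : noncross F.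
  move=> p q pF qF; apply/negP => cr.
  move: (pF) (qF); rewrite !memF => /andP[/chordE[i [j [ij ep ec]]] pD].
  move=> /andP[/chordE[k [l [kl eq ec']]] qD]; subst p q.
  have neq : chord (val i, val j) != chord (val k, val l).
    rewrite ec ec'; apply: contraTneq cr => /(set2_inj ij kl)[-> ->].
    by rewrite /crosses ltnn.
  have := ncD _ _ pD qD neq; apply/eqP; rewrite ec ec'.
  by apply/set0P; apply: open_hull_crossing.
have rootF : (0, N.+1)%N \notin F by apply/negP => /gapF[]; rewrite eqxx.
have [|||_ [|t szt Et]] := @noncross_max 0 N ((0, N.+1)%N :: F).
- by rewrite /= rootF.
- move=> p q; rewrite !inE => /orP[/eqP->|pF] /orP[/eqP->|qF]; last exact: ncF.
  + by rewrite /crosses.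
  + by case: q qF => x y /gapF[? ? ?]; rewrite /crosses /=; lia.
  + by case: p pF => x y /gapF[? ? ?]; rewrite /crosses /=; lia.
- by move=> x y; rewrite inE => /orP[/eqP[-> ->]|/gapF[? ? ?]]; split; lia.
- by rewrite /= szF prednK.
exists t; first by rewrite mem_trees szt.
apply/setP => e; apply/idP/idP => [eD|].
  have [i [j [ij ee _]]] := diagE e eD.
  have eF : (val i, val j) \in F by rewrite memF unfold_in /= ij ltn_ord chord_val -ee.
  by rewrite ee mem_dissection // -Et inE eF orbT andbT; have [] := gapF _ _ eF.
rewrite inE => /mapP[p]; rewrite mem_filter -Et inE => /andP[/negbTE->] /= + ->.
by rewrite memF => /andP[].
Qed.

Lemma angle_vertex (a b c : 'I_n) i : a = 0%N :> nat -> (0 < b)%N -> (b < c)%N ->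
  (angle (vertex R a) (vertex R b) (vertex R c) == pi * i.+1%:R / n%:R) =
  (c - b.+1 == i)%N.
Proof.
move=> a0 b_gt0 lt_bc; rewrite !vertex_pt a0 angle_pt0 //.
rewrite (inj_eq (mulIf _)); last by rewrite invr_eq0 pnatr_eq0.
rewrite (inj_eq (mulfI _)); last by rewrite gt_eqF ?pi_gt0.
by rewrite eqr_nat; lia.
Qed.

Lemma angle_count_dissection t i : tsize t = N ->
  angle_count R i.+1 (dissection t) = count_mem i (spine t).
Proof.
move=> sz; rewrite -(spine_nodes 0 t) count_map -size_filter -filter_predI.
pose P := predI (preim (fun p : nat * nat * nat => (p.2 - p.1.2.+1)%N) (pred1 i))
  (fun p => p.1.1 == 0%N).
rewrite -/P -(size_map (triangle)) -card_set_seq; last first.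
  rewrite map_inj_in_uniq ?filter_uniq ?uniq_nodes // => p q.
  by rewrite !mem_filter => /andP[_ pt] /andP[_ qt]; apply: (triangle_inj sz).
congr #|pred_of_set _|; apply/setP => s; rewrite trianglesE // !inE.
have angleP (j k l : 'I_n) : (j < k)%N -> (k < l)%N ->
    [exists a : 'I_n, exists b : 'I_n, exists c : 'I_n,
      [&& nat_of_ord a == 0%N, [set j; k; l]%SET == [set a; b; c]%SET &
        angle (vertex R a) (vertex R b) (vertex R c) == pi * i.+1%:R / n%:R]] =
    P (val j, val k, val l).
  move=> jk kl; apply/existsP/idP => [[a /existsP[b /existsP[c]]]|/andP[/= li /eqP j0]].
    case/and3P=> /eqP a0 /eqP/setP E.
    move: (E a) (E b) (E c) (E j) (E k) (E l); rewrite !inE !eqxx ?orbT -!val_eqE /= a0.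
    move=> Ea Eb Ec Ej Ek El.
    have j0 : j = 0%N :> nat by lia.
    (* The vertex set of a triangle does not order [b] and [c], so both orders occur; the symmetry
       of [angle] reduces one to the other. *)
    have : (b == k) && (c == l) || (b == l) && (c == k) by rewrite -!val_eqE /=; lia.
    rewrite /P /= j0 eqxx andbT.
    case/orP=> /andP[/eqP-> /eqP->]; last rewrite angleC.
      by rewrite angle_vertex //; lia.
    by rewrite angle_vertex //; lia.
  exists j; apply/existsP; exists k; apply/existsP; exists l.
  by rewrite j0 !eqxx angle_vertex //; lia.
apply/andP/mapP => [[/mapP[p pt ->]]|[p]].
  have [j [k [l [jk kl ep ->]]]] := triangleE sz pt.
  rewrite angleP // -ep => Pp; exists p; rewrite ?mem_filter ?Pp //.
  by rewrite ep triangle_val.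
rewrite mem_filter => /andP[Pp pt] ->; split; first exact: map_f.
have [j [k [l [jk kl ep ->]]]] := triangleE sz pt.
by rewrite angleP // -ep.
Qed.

Lemma dissection_inj : {in trees N &, injective (dissection)}.
Proof.
move=> t t'; rewrite !mem_trees => /eqP sz /eqP sz' E.
apply: (@diags_inj 0); first by rewrite sz sz'.
have sub u u' : tsize u = N -> tsize u' = N -> dissection u = dissection u' ->
    {subset diags 0 u <= diags 0 u'}.
  move=> szu szu' Eu p pu; have [i [j [ij ep ec]]] := chordE (diags_valid szu pu).
  case: (eqVneq p (0, N.+1)%N) => [->|p0]; first exact: root_diags.
  have : [set i; j]%SET \in dissection u by rewrite mem_dissection // -ep p0.
  by rewrite Eu mem_dissection // -ep => /andP[].
by move=> p; apply/idP/idP; apply: sub.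
Qed.

Lemma triangulationsE :
  triangulations R n = [set:: map (dissection) (trees N)]%SET.
Proof.
apply/setP => D; rewrite !inE; apply/asboolP/mapP => [/triangulation_dissection//|].
by case=> t; rewrite mem_trees => /eqP sz ->; apply: dissection_triangulation.
Qed.

Lemma card_triangulations : #|triangulations R n| = size (trees N).
Proof.
rewrite triangulationsE card_set_seq ?size_map //.
by rewrite map_inj_in_uniq ?uniq_trees //; apply: dissection_inj.
Qed.

Lemma card_angle_count (k : nat -> nat) :
  #|[set D in triangulations R n |
      [forall i : 'I_N, angle_count R i.+1 D == k i]]%SET| =
  count (has_spine N k) (trees N).
Proof.
rewrite -size_filter -(size_map (dissection)) -card_set_seq; last first.
  rewrite map_inj_in_uniq ?filter_uniq ?uniq_trees // => t t'.
  by rewrite !mem_filter => /andP[_ ?] /andP[_ ?]; apply: dissection_inj.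
have spineP t : t \in trees N -> [forall i : 'I_N, angle_count R i.+1 (dissection t) == k i]
    = has_spine N k t.
  rewrite mem_trees => /eqP sz; apply/forallP/allP => H i.
    by rewrite mem_iota => /andP[_ iN]; have := H (Ordinal iN); rewrite angle_count_dissection.
  by rewrite angle_count_dissection //; apply: H; rewrite mem_iota /= add0n.
congr #|pred_of_set _|; apply/setP => D; rewrite inE triangulationsE !inE.
apply/andP/mapP => [[/mapP[t tN ->]]|[t]].
  by rewrite spineP // => st; exists t; rewrite ?mem_filter ?st.
by rewrite mem_filter => /andP[st tN] ->; rewrite map_f // spineP.
Qed.

End Triangulations.

(** * Events under a uniform law *)

Lemma uniform_on_event d (Omega : measurableType d) (R : realType)
    (P : probability Omega R) (I : finType) (X : Omega -> I) (S A : {set I}) :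
  uniform_on P X S ->
  P [set w | X w \in A] = (#|S :&: A|%:R / #|S|%:R)%:E.
Proof.
move=> uX.
have -> : [set w | X w \in A] = \bigcup_(x in [set` enum A]) (X @^-1` [set x]).
  apply/seteqP; split=> [w /= wA|w [x /=]].
    by exists (X w); rewrite /= ?mem_enum.
  by rewrite mem_enum => xA ->.
rewrite measure_fin_bigcup //; last by move=> x _; have [] := uX x.
  rewrite -fsbig_seq ?enum_uniq //= big_enum /=.
  under eq_bigr do rewrite (uX _).2.
  rewrite sumEFin -mulr_suml -natr_sum -big_mkcondr sum1_card; congr (_%:R / _)%:E.
  by apply: eq_card => x; rewrite !inE andbC.
by move=> x y _ _ [w [/= -> ->]].
Qed.

(** * Weights and tree counts *)

Section Weights.
Set Implicit Arguments.
Unset Strict Implicit.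
Variable R : realType.

Lemma catalan_trees j : catalan R j = (size (trees j))%:R.
Proof.
rewrite /catalan -size_trees natrM mulfK // pnatr_eq0 //.
Qed.

(** Extension by 0, since [has_spine] reads multiplicities indexed by [nat]. *)
Definition ext0 N (k : 'I_N -> nat) (j : nat) : nat := oapp k 0%N (insub j).

Lemma ext0E N (k : 'I_N -> nat) (i : 'I_N) : ext0 k i = k i.
Proof. by rewrite /ext0 valK. Qed.

Lemma weight_count N (k : 'I_N -> nat) : (\sum_(i < N) i.+1 * k i)%N = N ->
  weight R (\sum_(i < N) k i) k = (count (has_spine N (ext0 k)) (trees N))%:R.
Proof.
move=> k_sum; have := @count_has_spine N (ext0 k) N (leqnn N).
under eq_bigr do rewrite ext0E.
under [X in (_ * X)%N = _]eq_bigr do rewrite ext0E.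
under [X in (X`! * _)%N]eq_bigr do rewrite ext0E.
under [X in (_`! * X)%N]eq_bigr do rewrite ext0E.
move=> /(_ k_sum) /(congr1 (fun m => m%:R : R)); rewrite !natrM !natr_prod => e.
rewrite /weight /multinomial.
have -> : \prod_(j < N) catalan R j ^+ k j = \prod_(j < N) (size (trees j) ^ k j)%:R.
  by apply: eq_bigr => j _; rewrite catalan_trees natrX.
rewrite mulrAC -e mulfK //; apply/prodf_neq0 => i _.
by rewrite pnatr_eq0 -lt0n fact_gt0.
Qed.

Lemma sum_count_mem N (f : nat -> nat) s : all (fun x => x < N)%N s ->
  (\sum_(j < N) f j * count_mem (val j) s)%N = (\sum_(x <- s) f x)%N.
Proof.
elim: s => [_|x s IH /= /andP[xN /IH sE]].
  by rewrite big_nil big1 // => j _; rewrite muln0.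
rewrite big_cons -sE; under eq_bigr do rewrite mulnDr.
rewrite big_split /= (bigD1 (Ordinal xN)) //= eqxx muln1 big1 ?addn0 // => j.
by rewrite -val_eqE /= eq_sym => /negbTE ->; rewrite muln0.
Qed.

Lemma spine_lt t : all (fun x => x < tsize t)%N (spine t).
Proof.
elim: t => //= l IHl r _; apply/andP; split; first by lia.
by apply: sub_all IHl => x /=; lia.
Qed.

(** Exchanging the sums over tuples and trees: each tree matches exactly one tuple [q], its spine
    multiplicities, and [q] is admissible exactly when the spine has length [K]. The bound [n - 2]
    on the entries loses nothing, as a multiplicity is at most the size of the tree. *)
Lemma Z_trees M K : Z R M.+3 K = (size (spine_trees M.+1 K))%:R.
Proof.
pose N := M.+1; rewrite /Z.
have cntE (p : {ffun 'I_N -> 'I_N.+1}) :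
    (\sum_(j < N) j.+1 * p j == N)%N && (\sum_(j < N) p j == K)%N ->
    weight R K (fun j => p j : nat) =
    (\sum_(t <- trees N) has_spine N (ext0 (fun j => p j : nat)) t)%:R.
  move=> /andP[/eqP p_sum /eqP <-]; rewrite weight_count //.
  by rewrite -sum1_count big_mkcond.
rewrite (eq_bigr _ cntE) -natr_sum; congr _%:R.
rewrite exchange_big /= size_filter -sum1_count [RHS]big_mkcond /=.
apply: eq_big_seq => t; rewrite mem_trees => /eqP sz.
pose q : {ffun 'I_N -> 'I_N.+1} := [ffun j => inord (count_mem (val j) (spine t))].
have qE j : q j = count_mem (val j) (spine t) :> nat.
  rewrite ffunE inordK // ltnS (leq_trans (count_size _ _)) //.
  by rewrite (leq_trans (size_spine_le t)) ?sz.
have spN := spine_lt t; rewrite sz in spN.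
have q_sum : (\sum_(j < N) j.+1 * q j = N)%N.
  under eq_bigr do rewrite qE.
  rewrite (sum_count_mem succn) //.
  have -> : (\sum_(x <- spine t) x.+1 = sumn (spine t) + size (spine t))%N.
    rewrite sumnE -sum1_size -big_split /=; apply: eq_bigr => x _; lia.
  by rewrite sum_spine.
have q_size : (\sum_(j < N) q j = size (spine t))%N.
  under eq_bigr do rewrite qE -[count_mem _ _]mul1n.
  by rewrite (sum_count_mem (fun=> 1%N)) // sum1_size.
have spineP (p : {ffun 'I_N -> 'I_N.+1}) :
    has_spine N (ext0 (fun j => p j : nat)) t = (p == q).
  apply/allP/eqP => [H|-> j].
    apply/ffunP => j; apply: val_inj; rewrite /= qE.
    have := H j; rewrite mem_iota /= => /(_ (ltn_ord j)) /eqP ->.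
    by rewrite ext0E.
  by rewrite mem_iota => /andP[_ jN]; rewrite -[j]/(val (Ordinal jN)) ext0E qE.
under eq_bigr do rewrite spineP.
rewrite big_mkcond (bigD1 q) //= [X in (_ + X)%N]big1 => [|p /negbTE->]; last by rewrite if_same.
by rewrite eqxx q_sum q_size eqxx addn0.
Qed.

End Weights.

(** * The law of the angle counts *)

Section Probability.
Set Implicit Arguments.
Unset Strict Implicit.

Lemma angle_counts_probability (R : realType) (M : nat)
    (d : measure_display) (Omega : measurableType d) (P : probability Omega R)
    (Tn : Omega -> {set {set 'I_M.+3}})
    (Tn_uniform : uniform_on P Tn (triangulations R M.+3))
    (k : 'I_M.+1 -> nat) (k_sum : (\sum_(i < M.+1) i.+1 * k i)%N = M.+1) :
  P [set w | forall i : 'I_M.+1, angle_count R i.+1 (Tn w) = k i] =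
  (weight R (\sum_(i < M.+1) k i) k / catalan R M.+1)%:E.
Proof.
pose A : {set {set {set 'I_M.+3}}} :=
  [set D | [forall i : 'I_M.+1, angle_count R i.+1 D == ext0 k i]]%SET.
have -> : [set w | forall i : 'I_M.+1, angle_count R i.+1 (Tn w) = k i] =
    [set w | Tn w \in A].
  apply/seteqP; split=> w /=.
    by move=> H; rewrite inE; apply/forallP => i; rewrite ext0E H.
  rewrite inE => /forallP H i.
  by have /eqP := H i; rewrite ext0E.
rewrite (uniform_on_event _ Tn_uniform) weight_count // catalan_trees.
rewrite card_triangulations // -(@card_angle_count R M.+1) //; congr (_%:R / _)%:E.
by apply: eq_card => D; rewrite !inE.
Qed.

End Probability.

Theorem theorem6 (R : realType) (n : nat) (n_ge3 : (3 <= n)%N)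
    (d : measure_display) (Omega : measurableType d) (P : probability Omega R)
    (Tn : Omega -> {set {set 'I_n}})
    (Tn_uniform : uniform_on P Tn (triangulations R n))
    (k : 'I_(n - 2) -> nat)
    (k_le : forall i, (k i <= n - 2)%N)
    (k_sum : (\sum_(i < n - 2) i.+1 * k i)%N = (n - 2)%N) :
  let K := (\sum_(i < n - 2) k i)%N in
  P [set w | forall i : 'I_(n - 2), angle_count R i.+1 (Tn w) = k i] =
    ((K%:R * (2 * n - K - 5)`!%:R)
       / (Z R n K * catalan R (n - 2) * (n - K - 2)`!%:R * (n - 2)`!%:R)
     * multinomial R K k * \prod_(i < n - 2) catalan R i ^+ k i)%:E.
Proof.
case: n n_ge3 Tn Tn_uniform k k_le k_sum => [|[|[|M]]] // _ Tn Tn_uniform.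
change (M.+3 - 2)%N with M.+1 => k _ k_sum K.
rewrite angle_counts_probability // -/K; congr _%:E.
have K_gt0 : (0 < K)%N.
  rewrite lt0n; apply: contra_eqN k_sum => /eqP/eqP.
  rewrite sum_nat_eq0 => /forallP k0; rewrite big1 // => i _.
  by have /implyP/(_ isT)/eqP -> := k0 i; rewrite muln0.
have K_le : (K <= M.+1)%N.
  by rewrite -k_sum; apply: leq_sum => i _; rewrite leq_pmull.
(* With [s = n - 2 - K] nodes off the spine, [2s + K - 1] is [2n - K - 5]. *)
have := @ballot K (M.+1 - K) ltac:(lia); rewrite subnKC // subnK //.
have -> : (2 * (M.+1 - K) + K).-1 = (2 * M.+3 - K - 5)%N by lia.
have -> : (M.+3 - K - 2 = M.+1 - K)%N by lia.
set f := (M.+1)`!; set g := (2 * M.+3 - K - 5)`! => e.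
have {}e : Z R M.+3 K * ((M.+1 - K)`!%:R * f%:R) = K%:R * g%:R.
  by rewrite Z_trees -!natrM e.
have Kf : K%:R * g%:R != 0 :> R.
  by rewrite mulf_neq0 ?pnatr_eq0 -?lt0n // fact_gt0.
(* The ballot identity turns the denominator into the numerator times [C_{n-2}]; the numerator is
   nonzero because [K > 0]. *)
rewrite -(mulrA (Z R M.+3 K * catalan R M.+1)) (mulrAC (Z R M.+3 K)) e.
have -> (c : R) : K%:R * g%:R / (K%:R * g%:R * c) = c^-1.
  by rewrite invfM mulVKf.
by rewrite mulrC mulrA.
Qed.
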